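(* Let $d\ge 3$ be fixed and let $\{G_k\}$ be a family of connected $d$-regular simple graphs with $|V(G_k)|\to\infty$ as $k\to\infty$. Then \[ \lim_{k\to\infty}\frac{\mathscr{K}_{nb}(G_k)}{\mathscr{K}_e(G_k)}\le 1-\frac{1}{d^2}. \]
   Context: Kemeny's constant of an irreducible finite Markov chain with transition matrix $P$ whose eigenvalues (with multiplicity) are $1=\rho_1,\rho_2,\dots,\rho_N$ (with $1$ simple) is $\mathscr{K}(P)=\sum_{i=2}^{N}\frac{1}{1-\rho_i}$. Arcs of $G$: for each edge $\{u,v\}$ the two ordered pairs $(u,v),(v,u)$. $\mathscr{K}_e(G)$ is Kemeny's constant of the chain on arcs where from $(u,v)$ one moves to $(v,w)$ with probability $1/\deg(v)$ for each neighbor $w$ of $v$. $\mathscr{K}_{nb}(G)$ is Kemeny's constant of the non-backtracking chain on arcs where from $(u,v)$ one moves to $(v,w)$ with probability $1/(\deg(v)-1)$ for each neighbor $w\neq u$ of $v$.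
   Formalization: The limit need not exist (e.g. alternate cubic expanders with prisms), so the formal statement bounds the limit superior: for every ε > 0, eventually K_nb(G_k)/K_e(G_k) ≤ 1 − 1/d² + ε; this gives the stated bound whenever the limit exists. *)

(* Defs.v *)
From mathcomp Require Import all_boot all_order all_algebra all_field.
Set Implicit Arguments. Unset Strict Implicit. Unset Printing Implicit Defensive.
Import Order.TTheory GRing.Theory Num.Theory.
Local Open Scope ring_scope.

(* Complex eigenvalues (with algebraic multiplicity) of a square matrix over
   algC: the roots, with multiplicity, of its characteristic polynomial. *)
Definition poly_roots (p : {poly algC}) : seq algC :=
  sval (closed_field_poly_normal p).

Definition eigenvalues_mx n (P : 'M[algC]_n) : seq algC := poly_roots (char_poly P).

(* Kemeny's constant: sum of 1/(1 - rho) over all eigenvalues, with ONE copy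
   of the (simple) eigenvalue 1 removed. *)
Definition kemeny n (P : 'M[algC]_n) : algC :=
  \sum_(z <- rem 1 (eigenvalues_mx P)) (1 - z)^-1.

Section Graph.
Variables (V : finType) (E : rel V).

Definition arc_pred : pred (V * V) := fun p => E p.1 p.2.
Definition arc : finType := {p : V * V | arc_pred p}.

Definition deg (v : V) : nat := #|[set w | E v w]|.

Definition arc_of (i : 'I_#|{: arc}|) : V * V := val (enum_val i).

Definition edge_walk_mx : 'M[algC]_#|{: arc}| :=
  \matrix_(i, j) if (arc_of i).2 == (arc_of j).1
                 then ((deg (arc_of i).2)%:R)^-1 else 0.

Definition nb_walk_mx : 'M[algC]_#|{: arc}| :=
  \matrix_(i, j) if ((arc_of i).2 == (arc_of j).1) && ((arc_of j).2 != (arc_of i).1)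
                 then ((deg (arc_of i).2 - 1)%:R)^-1 else 0.

Definition kemeny_e : algC := kemeny edge_walk_mx.
Definition kemeny_nb : algC := kemeny nb_walk_mx.

Definition simple_graph : Prop := symmetric E /\ irreflexive E.
Definition connected_graph : Prop := forall x y : V, connect E x y.
Definition regular_graph (d : nat) : Prop := forall v : V, deg v = d.

End Graph.

(* Main.v *)
Require Import Defs.
From mathcomp Require Import all_boot all_order all_algebra all_field.
From mathcomp Require Import ring.
Set Implicit Arguments. Unset Strict Implicit. Unset Printing Implicit Defensive.
Import Order.TTheory GRing.Theory Num.Theory.
Local Open Scope ring_scope.

(** Since [0^-1 = 0], Kemeny's constant is the sum of [(1 - z)^-1] over all roots
    of the characteristic polynomial, a quantity additive on products of monic
    polynomials.  Let [n] be the number of vertices and [L_i] the eigenvalues of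
    the adjacency matrix.  Sylvester's determinant identity (for the edge walk)
    and the Ihara-Bass factorization (for the non-backtracking walk) express
    both characteristic polynomials through the [L_i], and with
    [K = \sum_(L_i != d) (1 - L_i / d)^-1] they give
      [K_e = n (d - 1) + K],
      [K_nb = n (d^2 - d + 1) / d + 1 / (d - 2) + (d - 2) / d * K].
    The ratio decreases with [K], and [K >= n - 2] because the [L_i] sum to zero
    and, by connectedness, [d] is a simple eigenvalue larger than all others. *)


(** * Sums over the roots of monic polynomials *)

Definition inv_root_sum (p : {poly algC}) : algC :=
  \sum_(z <- poly_roots p) (1 - z)^-1.

Lemma poly_rootsE p :
  p = lead_coef p *: \prod_(z <- poly_roots p) ('X - z%:P).
Proof. exact: svalP (closed_field_poly_normal p). Qed.

Lemma perm_poly_roots p (s : seq algC) :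
  p = \prod_(z <- s) ('X - z%:P) -> perm_eq (poly_roots p) s.
Proof.
move=> ps; apply: prod_XsubC_eq.
have := poly_rootsE p; rewrite {2}ps lead_coef_prod_XsubC scale1r.
by rewrite -ps.
Qed.

Lemma inv_root_sum_prod (s : seq algC) :
  inv_root_sum (\prod_(z <- s) ('X - z%:P)) = \sum_(z <- s) (1 - z)^-1.
Proof. by apply: perm_big; apply: perm_poly_roots. Qed.

Lemma inv_root_sum_XsubC a : inv_root_sum ('X - a%:P) = (1 - a)^-1.
Proof. by have := inv_root_sum_prod [:: a]; rewrite !big_seq1. Qed.

Lemma inv_root_sumM p q : p \is monic -> q \is monic ->
  inv_root_sum (p * q) = inv_root_sum p + inv_root_sum q.
Proof.
move=> /monicP p1 /monicP q1.
rewrite {1}[p]poly_rootsE {1}[q]poly_rootsE p1 q1 !scale1r -big_cat.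
by rewrite inv_root_sum_prod big_cat.
Qed.

Lemma inv_root_sum1 : inv_root_sum 1 = 0.
Proof. by have := inv_root_sum_prod [::]; rewrite !big_nil. Qed.

Lemma inv_root_sum_bigprod (I : finType) (F : I -> {poly algC}) :
  (forall i, F i \is monic) ->
  inv_root_sum (\prod_i F i) = \sum_i inv_root_sum (F i).
Proof.
(* Monicity of the partial products is carried through the induction because additivity requires
   it. *)
move=> F1; suff [//] : inv_root_sum (\prod_i F i) = \sum_i inv_root_sum (F i)
   /\ \prod_i F i \is monic.
elim/big_rec2: _ => [|i s p _ [<- p1]]; first by rewrite inv_root_sum1 monic1.
by rewrite inv_root_sumM // monicMl.
Qed.

Lemma inv_root_sumX p n : p \is monic ->
  inv_root_sum (p ^+ n) = inv_root_sum p *+ n.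
Proof.
move=> p1; rewrite -[n in LHS]card_ord -prodr_const inv_root_sum_bigprod //.
by rewrite sumr_const card_ord.
Qed.

Lemma size_quadratic_tail (a b : algC) :
  (size (- (a *: 'X) + b%:P)%R < 3)%N.
Proof.
apply: leq_ltn_trans (size_polyD _ _) _; rewrite gtn_max size_polyN.
rewrite (leq_ltn_trans (size_scale_leq _ _)) ?size_polyX //=.
exact: leq_ltn_trans (size_polyC_leq1 _) _.
Qed.

Lemma monic_quadratic (a b : algC) : 'X^2 - a *: 'X + b%:P \is monic.
Proof.
by rewrite monicE -addrA lead_coefDl ?lead_coefXn // size_polyXn size_quadratic_tail.
Qed.

(** The value is the logarithmic derivative p'(1) / p(1); the hypothesis says that 1 is not a
    root. *)
Lemma inv_root_sum_quadratic (a b : algC) : 1 - a + b != 0 ->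
  inv_root_sum ('X^2 - a *: 'X + b%:P) = (2 - a) / (1 - a + b).
Proof.
set p := _ + b%:P => p1; have monp : p \is monic := monic_quadratic a b.
have pE := poly_rootsE p; rewrite (monicP monp) scale1r in pE.
have sp : size p = 3.
  by rewrite /p -addrA size_polyDl ?size_polyXn // size_quadratic_tail.
move: sp; rewrite pE size_prod_XsubC /inv_root_sum -pE.
case: (poly_roots p) pE => [|x [|y []]] //= pE _.
rewrite !big_cons big_nil mulr1 in pE; rewrite !big_cons big_nil addr0.
have ev t : t ^+ 2 - a * t + b = (t - x) * (t - y).
  by have := congr1 (horner^~ t) pE; rewrite /p !hornerE.
have e0 : b = x * y by have := ev 0; rewrite expr0n mulr0 !sub0r oppr0 add0r mulrNN.
have e1 : a = x + y.
  have := ev 1; rewrite e0 => h; apply/eqP; rewrite -subr_eq0; apply/eqP.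
  have -> : a - (x + y) = (1 - x) * (1 - y) - (1 ^+ 2 - a * 1 + x * y) by ring.
  by rewrite h subrr.
have p1E : 1 - a + b = (1 - x) * (1 - y) by rewrite e0 e1; ring.
have [x1 y1] : 1 - x != 0 /\ 1 - y != 0.
  by apply/andP; rewrite -negb_or -mulf_eq0 -p1E.
by rewrite p1E e1; field; rewrite x1 y1.
Qed.

(* The junk value [0^-1 = 0] makes the removal of the eigenvalue 1 harmless. *)
Lemma kemenyE n (P : 'M[algC]_n) : kemeny P = inv_root_sum (char_poly P).
Proof.
rewrite /kemeny /inv_root_sum /eigenvalues_mx.
set s := poly_roots _; case: (boolP (1 \in s)) => [s1|/rem_id -> //].
by rewrite [RHS](perm_big _ (perm_to_rem s1)) big_cons subrr invr0 /= add0r.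
Qed.

(** Two block eliminations of the same matrix [M]. Powers of [x] on both sides avoid dividing by
    [x], which will be a polynomial. *)
Lemma det_sylvester (R : comNzRingType) m n (x : R)
    (A : 'M[R]_(m, n)) (B : 'M[R]_(n, m)) :
  \det (x%:M - A *m B) * x ^+ n = x ^+ m * \det (x%:M - B *m A).
Proof.
pose M := block_mx x%:M A B 1%:M.
have <- : \det M = \det (x%:M - A *m B).
  have := det_mulmx M (block_mx 1%:M 0 (- B) 1%:M).
  rewrite det_lblock !det1 !mulr1 => <-.
  rewrite /M mulmx_block !mulmx1 !mul1mx !mulmx0 !add0r mulmxN subrr.
  by rewrite det_ublock det1 mulr1.
have := det_mulmx (block_mx 1%:M 0 (- B) x%:M) M.
rewrite det_lblock det1 mul1r det_scalar mulrC => <-.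
rewrite /M mulmx_block !mulmx1 !mul1mx !mul0mx !addr0 mulNmx.
rewrite mul_mx_scalar mul_scalar_mx addNr det_ublock det_scalar.
by rewrite addrC mulNmx.
Qed.


(** * Incidence and reversal matrices of arcs *)

Section ArcMatrices.
Variables (V : finType) (E : rel V) (R : comNzRingType).
Local Notation N := #|{: Defs.arc E}|.
Local Notation n := #|V|.

(** The ring is general: determinants are taken over [{poly algC}], the adjacency spectrum over
    [algC]. *)
Definition source_mx : 'M[R]_(N, n) :=
  \matrix_(i, v) ((arc_of i).1 == enum_val v)%:R.
Definition target_mx : 'M[R]_(N, n) :=
  \matrix_(i, v) ((arc_of i).2 == enum_val v)%:R.
Definition reversal_mx : 'M[R]_N :=
  \matrix_(i, j) (((arc_of i).2 == (arc_of j).1)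
                  && ((arc_of j).2 == (arc_of i).1))%:R.
Definition adjacency_mx : 'M[R]_n :=
  \matrix_(u, v) (E (enum_val u) (enum_val v))%:R.

Lemma arc_of_inj : injective (@arc_of V E).
Proof. by move=> i j /val_inj /enum_val_inj. Qed.

Lemma arc_ofP i : E (@arc_of V E i).1 (arc_of i).2.
Proof. exact: valP (enum_val i). Qed.

Lemma sum_arcs (F : V -> V -> R) :
  \sum_(i < N) F (arc_of i).1 (arc_of i).2 = \sum_u \sum_(v | E u v) F u v.
Proof.
rewrite pair_big_dep /=.
transitivity (\sum_(a : Defs.arc E) F (val a).1 (val a).2).
  rewrite -(big_enum_val (fun a : Defs.arc E => F (val a).1 (val a).2)).
  by apply: eq_bigl.
rewrite [RHS](reindex_omap (val : Defs.arc E -> V * V) insub) => [|p Ep].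
  by apply: eq_bigl => a; rewrite valK eqxx andbT; apply/esym/(valP a).
by rewrite insubT.
Qed.

Lemma sum_delta (v : V) (F : V -> R) :
  \sum_(i < n) (v == enum_val i)%:R * F (enum_val i) = F v.
Proof.
rewrite (bigD1 (enum_rank v)) //= enum_rankK eqxx mul1r big1 ?addr0 // => i.
by rewrite -(inj_eq enum_val_inj) enum_rankK eq_sym => /negPf ->; rewrite mul0r.
Qed.

(** Up to the factor 1 / d this product is the edge walk. The opposite product is the adjacency
    matrix, so [det_sylvester] passes from arcs to vertices. *)
Lemma target_source i j : (target_mx *m source_mx^T) i j =
  ((arc_of i).2 == (arc_of j).1)%:R.
Proof.
rewrite mxE; under eq_bigr do rewrite !mxE.
by rewrite (sum_delta _ (fun v => ((arc_of j).1 == v)%:R)) eq_sym.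
Qed.

Lemma source_target : source_mx^T *m target_mx = adjacency_mx.
Proof.
apply/matrixP=> u v; rewrite !mxE; under eq_bigr do rewrite !mxE.
rewrite (sum_arcs (fun x y => (x == enum_val u)%:R * (y == enum_val v)%:R)).
rewrite (bigD1 (enum_val u)) //= [X in _ + X]big1 => [|x /negPf xu]; last first.
  by rewrite big1 // => y _; rewrite xu mul0r.
rewrite addr0 big_mkcond (bigD1 (enum_val v)) //= !eqxx mul1r.
rewrite big1 => [|y /negPf ->]; first by case: ifP; rewrite addr0.
by rewrite mulr0 if_same.
Qed.

Lemma source_source d : regular_graph E d -> source_mx^T *m source_mx = d%:R%:M.
Proof.
move=> Ed; apply/matrixP=> u v; rewrite !mxE; under eq_bigr do rewrite !mxE.
rewrite (sum_arcs (fun x y => (x == enum_val u)%:R * (x == enum_val v)%:R)).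
rewrite (bigD1 (enum_val u)) //= [X in _ + X]big1 => [|x /negPf xu]; last first.
  by rewrite big1 // => y _; rewrite xu mul0r.
rewrite addr0 eqxx mul1r (inj_eq enum_val_inj) sumr_const.
rewrite -(Ed (enum_val u)) /deg cardsE.
by case: (u == v); rewrite ?mul0rn // mulr0n.
Qed.

Hypothesis Esym : symmetric E.

(** Left multiplication by the reversal matrix permutes rows; once a column is a function of the
    endpoints, this swaps its arguments. *)
Lemma reversal_mulE m (M : 'M[R]_(N, m)) i (F : V -> V -> R) j :
    (forall k, M k j = F (arc_of k).1 (arc_of k).2) ->
  (reversal_mx *m M) i j = F (arc_of i).2 (arc_of i).1.
Proof.
move=> MF; rewrite mxE; under eq_bigr do rewrite mxE MF.
rewrite (sum_arcs (fun x y =>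
  (((arc_of i).2 == x) && (y == (arc_of i).1))%:R * F x y)).
rewrite (bigD1 (arc_of i).2) //= [X in _ + X]big1 => [|x]; last first.
  by rewrite eq_sym => /negPf xu; rewrite big1 // => y _; rewrite xu mul0r.
rewrite addr0 (bigD1 (arc_of i).1) /=; last by rewrite Esym arc_ofP.
rewrite !eqxx mul1r big1 ?addr0 // => y /andP[_ /negPf ->].
by rewrite mul0r.
Qed.

Lemma reversal_target : reversal_mx *m target_mx = source_mx.
Proof.
apply/matrixP=> i v; rewrite [RHS]mxE.
rewrite (@reversal_mulE _ _ _ (fun x y => (y == enum_val v)%:R)) // => k.
by rewrite mxE.
Qed.

Lemma reversal_reversal : reversal_mx *m reversal_mx = 1%:M.
Proof.
apply/matrixP=> i j; rewrite [RHS]mxE.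
rewrite (@reversal_mulE _ _ _ (fun x y =>
   ((y == (arc_of j).1) && ((arc_of j).2 == x))%:R)); last first.
  by move=> k; rewrite mxE.
congr (nat_of_bool _)%:R; rewrite -(inj_eq arc_of_inj) -pair_eqE /pair_eq /=.
by rewrite (eq_sym (arc_of j).2).
Qed.

(* Flipping the sign of one arc in each reversal pair conjugates the reversal
   matrix to its opposite, so its eigenvalues come in opposite pairs. *)
Lemma det_reversal_opp (x c : R) : irreflexive E ->
  \det (x%:M + c *: reversal_mx) = \det (x%:M - c *: reversal_mx).
Proof.
move=> Eirr.
(* An ordering of the vertices selects one arc of each reversal pair; without loops the two ends are
   always distinct. *)
pose s i : R := (-1) ^+ (enum_rank (@arc_of V E i).1 < enum_rank (arc_of i).2)%N.
pose D := diag_mx (\row_i s i).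
have ss i : s i * s i = 1 by rewrite -expr2 sqrr_sign.
have DD : \det D * \det D = 1.
  rewrite -det_mulmx mulmx_diag -[RHS](det1 R N); congr (\det _).
  apply/matrixP => i j; rewrite !mxE; case: eqP => // ->; rewrite ?mulr1n.
  by rewrite ss.
rewrite -[LHS]mul1r -DD -mulrA [\det D * \det (_ + _)]mulrC -!det_mulmx.
congr (\det _); rewrite mul_mx_diag mul_diag_mx; apply/matrixP=> i j.
rewrite !mxE; case: (i =P j) => [->|_].
  rewrite mulr1n; have -> : ((arc_of j).2 == (arc_of j).1) = false.
    by apply/eqP => h; have := arc_ofP j; rewrite h Eirr.
  by rewrite mulr0 addr0 subr0 mulrC -mulrA ss mulr1.
rewrite mulr0n add0r sub0r; case: andP => [[/eqP h1 /eqP h2]|_]; last first.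
  by rewrite mulr0 mul0r mulr0 oppr0.
have -> : s j = - s i.
  rewrite /s -h1 h2; case: (ltngtP (enum_rank (arc_of i).1) (enum_rank (arc_of i).2)).
  - by rewrite expr0 opprK.
  - by rewrite expr0.
  by move/val_inj/enum_rank_inj => h; have := arc_ofP i; rewrite h Eirr.
by rewrite mulr1 mulrN mulrN mulrC -mulrA ss mulr1.
Qed.

(** With J the reversal matrix, (x - cJ)(x + cJ) = x^2 - c^2, and both factors have the same
    determinant. The square avoids halving the number of arcs. *)
Lemma det_reversal_sqr (x c : R) : irreflexive E ->
  \det (x%:M - c *: reversal_mx) ^+ 2 = (x ^+ 2 - c ^+ 2) ^+ N.
Proof.
move=> Eirr; rewrite expr2 -{2}det_reversal_opp // -det_mulmx -det_scalar.
congr (\det _); rewrite mulmxBl !mulmxDr -!scalemxAl -!scalemxAr.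
rewrite reversal_reversal !mul_scalar_mx mul_mx_scalar.
by apply/matrixP=> i j; move: reversal_mx => J; rewrite !mxE; ring.
Qed.

(* Ihara-Bass: multiplying by [x - c J] turns the non-backtracking operator
   into a perturbation of a scalar matrix that factors through the vertices. *)
Lemma ihara_bass (x c : R) d : regular_graph E d ->
  \det (x%:M - c *: reversal_mx)
    * \det (x%:M - c *: (target_mx *m source_mx^T - reversal_mx))
    * (x ^+ 2 - c ^+ 2) ^+ n
  = (x ^+ 2 - c ^+ 2) ^+ N
    * \det ((x ^+ 2 - c ^+ 2 + c ^+ 2 * d%:R)%:M - (c * x) *: adjacency_mx).
Proof.
move=> Ed; rewrite -det_mulmx.
(* The terms linear in the reversal matrix cancel, and [reversal_target] turns the remaining mixed
   term into a product ending in [source_mx^T]. *)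
have -> : (x%:M - c *: reversal_mx) *m
    (x%:M - c *: (target_mx *m source_mx^T - reversal_mx)) =
    (x ^+ 2 - c ^+ 2)%:M - (c *: (x *: target_mx - c *: source_mx)) *m source_mx^T.
  rewrite mulmxBl !mulmxBr -!scalemxAl -!scalemxAr !mulmxBr mulmxBl.
  rewrite [reversal_mx *m (_ *m _)]mulmxA reversal_reversal reversal_target.
  rewrite -!scalemxAl !mul_scalar_mx mul_mx_scalar.
  move: reversal_mx (target_mx *m source_mx^T) (source_mx *m source_mx^T) => J A B.
  by apply/matrixP=> i j; rewrite !mxE; ring.
rewrite det_sylvester -!scalemxAr mulmxBr -!scalemxAr source_target.
rewrite (source_source Ed); congr (_ * \det _).
move: adjacency_mx => A.
by apply/matrixP=> i j; rewrite !mxE; ring.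
Qed.

End ArcMatrices.


(** * Spectrum of the adjacency matrix of a connected regular graph *)

Lemma det_diagonalizable n (A U : 'M[algC]_n) (L : 'rV_n) (a b : {poly algC}) :
    U \in unitmx -> A = invmx U *m diag_mx L *m U ->
  \det (a%:M - b *: map_mx polyC A) = \prod_i (a - b * (L 0 i)%:P).
Proof.
move=> uU ->; set W := map_mx polyC U; set W' := map_mx polyC (invmx U).
have WW : W' *m W = 1%:M by rewrite -map_mxM mulVmx // map_mx1.
have -> : a%:M - b *: map_mx polyC (invmx U *m diag_mx L *m U)
    = W' *m (a%:M - b *: map_mx polyC (diag_mx L)) *m W.
  rewrite !map_mxM mulmxBr mulmxBl -!scalemxAr -scalemxAl.
  by rewrite mul_mx_scalar -scalemxAl WW scalemx1.
rewrite !det_mulmx mulrAC -det_mulmx WW det1 mul1r map_diag_mx -scalemx1.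
rewrite -diag_const_mx -!linearZ -linearB det_diag /=.
by apply: eq_bigr => i _; rewrite !mxE mulr1.
Qed.

Section RegularGraph.
Variables (V : finType) (E : rel V) (d : nat).
Hypotheses (Esym : symmetric E) (Eirr : irreflexive E).
Hypothesis Ed : regular_graph E d.
Local Notation N := #|{: Defs.arc E}|.
Local Notation n := #|V|.
Local Notation A := (adjacency_mx E algC).

Lemma adjacency_sym i j : A i j = A j i.
Proof. by rewrite !mxE Esym. Qed.

Lemma adjacency_row_sum i : \sum_j A i j = d%:R.
Proof.
under eq_bigr do rewrite mxE.
transitivity (\sum_(v : V) (E (enum_val i) v)%:R : algC).
  rewrite (big_enum_val (fun v : V => (E (enum_val i) v)%:R)) /=.
  by apply: eq_bigl.
rewrite -(Ed (enum_val i)) /deg cardsE -sumr_const [RHS]big_mkcond /=.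
by apply: eq_bigr => v _; rewrite unfold_in; case: ifP.
Qed.

(** Expand the squared modulus: [f] collects the diagonal terms, [g] the cross terms. Its sign
    bounds the eigenvalues and its vanishing gives the simplicity of d. *)
Lemma dirichlet_form (v : 'rV[algC]_n) l : v *m A = l *: v ->
  \sum_i \sum_j A i j * `|v 0 i - v 0 j| ^+ 2
  = 2 * (d%:R - l) * \sum_i `|v 0 i| ^+ 2.
Proof.
move=> vA; have ev j : \sum_i v 0 i * A i j = l * v 0 j.
  by have /matrixP/(_ 0 j) := vA; rewrite !mxE.
pose f i j := A i j * `|v 0 i| ^+ 2.
pose g i j := v 0 i * A i j * (v 0 j)^*.
have -> : \sum_i \sum_j A i j * `|v 0 i - v 0 j| ^+ 2 =
    \sum_i \sum_j ((f i j + f j i) - (g i j + g j i)).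
  apply: eq_bigr => i _; apply: eq_bigr => j _.
  rewrite /f /g (adjacency_sym j i) !normCK rmorphB /=.
  by move: (A i j) => a; ring.
have sf : \sum_i \sum_j f i j = d%:R * \sum_i `|v 0 i| ^+ 2.
  by rewrite mulr_sumr; apply: eq_bigr => i _; rewrite -mulr_suml adjacency_row_sum.
have sg : \sum_i \sum_j g j i = l * \sum_i `|v 0 i| ^+ 2.
  rewrite mulr_sumr; apply: eq_bigr => i _; rewrite -mulr_suml ev normCK.
  by rewrite mulrA.
under eq_bigr do rewrite sumrB !big_split /=.
rewrite sumrB !big_split /= sg sf exchange_big /= sf.
rewrite [X in _ - (X + _)]exchange_big /= sg.
by ring.
Qed.

(** In [algC] this inequality also contains that [l] is real. *)
Lemma adjacency_eigenvalue_le (v : 'rV[algC]_n) l :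
  v != 0 -> v *m A = l *: v -> l <= d%:R.
Proof.
move=> v0 /dirichlet_form D.
have s0 : 0 < \sum_i `|v 0 i| ^+ 2.
  rewrite lt_def sumr_ge0 ?andbT => [|i _]; last by rewrite exprn_ge0.
  apply: contra v0; rewrite psumr_eq0 => [/allP h|i _]; last by rewrite exprn_ge0.
  apply/eqP/rowP => i; rewrite mxE; apply/eqP.
  by have := h i (mem_index_enum _); rewrite /= sqrf_eq0 normr_eq0.
have : 0 <= 2 * (d%:R - l) * \sum_i `|v 0 i| ^+ 2.
  rewrite -D; do 2![apply: sumr_ge0 => ? _]; rewrite mulr_ge0 ?exprn_ge0 //.
  by rewrite mxE ler0n.
by rewrite pmulr_lge0 // pmulr_rge0 ?ltr0n // subr_ge0.
Qed.

Lemma adjacency_top_eigenvector (v : 'rV[algC]_n) : connected_graph E ->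
  v *m A = d%:R *: v -> forall i j, v 0 i = v 0 j.
Proof.
move=> Econ /dirichlet_form; rewrite subrr mulr0 mul0r => D.
have pos i j : 0 <= A i j * `|v 0 i - v 0 j| ^+ 2.
  by rewrite mulr_ge0 ?exprn_ge0 // mxE ler0n.
have adj i j : E (enum_val i) (enum_val j) -> v 0 i = v 0 j.
  move=> Eij; have /eqP := D.
  rewrite psumr_eq0 => [/allP/(_ i (mem_index_enum _))/=|k _]; last exact: sumr_ge0.
  rewrite psumr_eq0 // => /allP/(_ j (mem_index_enum _))/=.
  by rewrite mxE Eij mul1r sqrf_eq0 normr_eq0 subr_eq0 => /eqP.
move=> i j; have /connectP[p] := Econ (enum_val i) (enum_val j).
elim: p i => [|x p IHp] i /=; first by move=> _ /enum_val_inj ->.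
case/andP; rewrite -[x]enum_rankK => /adj -> h; exact: IHp.
Qed.

Lemma adjacency_spectrum : (0 < n)%N -> connected_graph E ->
  exists (U : 'M[algC]_n) (L : 'rV[algC]_n) (i0 : 'I_n),
    [/\ U \in unitmx, A = invmx U *m diag_mx L *m U, L 0 i0 = d%:R,
        forall i, i != i0 -> L 0 i < d%:R & \sum_i L 0 i = 0].
Proof.
move=> n0 Econ; exists (spectralmx A), (spectral_diag A).
have uU := spectral_unit A.
have AE : A = invmx (spectralmx A) *m diag_mx (spectral_diag A) *m spectralmx A.
  apply/orthomx_spectralP; apply/hermitian_normalmx/realsym_hermsym.
    apply/is_hermitianmxP; rewrite expr0 scale1r map_mx_id //.
    by apply/matrixP=> i j; rewrite [RHS]mxE adjacency_sym.
  by apply/mxOverP=> i j; rewrite mxE realn.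
move: (spectralmx A) (spectral_diag A) uU AE => U L uU AE.
have rowA i : row i U *m A = L 0 i *: row i U.
  rewrite -row_mul AE !mulmxA mulmxV // mul1mx row_mul row_diag_mx.
  by rewrite -scalemxAl -rowE.
have rowN0 i : row i U != 0.
  apply/eqP=> h; have : (row i U *m invmx U) 0 i = 1.
    by rewrite -row_mul mulmxV // !mxE eqxx.
  by rewrite h mul0mx mxE => /eqP; rewrite eq_sym oner_eq0.
(* The constant vector is an eigenvector for d; a nonzero coordinate of it in the eigenbasis, listed
   in [w], supplies [i0]. *)
pose one : 'rV[algC]_n := const_mx 1.
pose w := one *m invmx U.
have oneA : one *m A = d%:R *: one.
  apply/rowP=> j; rewrite !mxE mulr1 -(adjacency_row_sum j).
  by apply: eq_bigr => i _; rewrite [one _ _]mxE mul1r adjacency_sym.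
have wL i : w 0 i * L 0 i = d%:R * w 0 i.
  have : w *m diag_mx L = d%:R *: w.
    rewrite /w scalemxAl -oneA [in RHS]AE !mulmxA mulmxK //.
  by move=> /rowP/(_ i); rewrite mul_mx_diag !mxE.
have [i0 wi0] : exists i, w 0 i != 0.
  have [i wi|h] := pickP (fun i => w 0 i != 0); first by exists i.
  have w0 : w = 0.
    by apply/rowP=> i; rewrite [RHS]mxE; apply/eqP/negPn/negbT/h.
  have : one = 0 by rewrite -[one](mulmxKV uU) -/w w0 mul0mx.
  by move/rowP/(_ (Ordinal n0))/eqP; rewrite !mxE oner_eq0.
(* A basis eigenvector for d is constant, so in eigenbasis coordinates a unit vector is a multiple
   of [w]. As [w] is nonzero at [i0], this forces [i = i0]. *)
have top i : L 0 i = d%:R -> exists a, forall j, (i == j)%:R = a * w 0 j.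
  move=> Li; have := rowA i; rewrite Li => /(adjacency_top_eigenvector Econ) cst.
  exists (U i i) => j.
  have -> : (i == j)%:R = (row i U *m invmx U) 0 j.
    by rewrite -row_mul mulmxV // !mxE.
  have -> : row i U = U i i *: one.
    by apply/rowP=> k; rewrite (cst k i) !mxE mulr1.
  by rewrite -scalemxAl [LHS]mxE.
have Li0 : L 0 i0 = d%:R by apply: (mulIf wi0); rewrite mulrC wL.
exists i0; split=> // [i ne|].
  rewrite lt_neqAle (adjacency_eigenvalue_le (rowN0 i) (rowA i)) andbT.
  apply/eqP=> /top[a ha].
  have := ha i0; rewrite (negPf ne) => /esym/eqP.
  rewrite mulf_eq0 (negPf wi0) orbF => /eqP a0.
  by have := ha i => /eqP; rewrite a0 mul0r eqxx oner_eq0.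
(* The eigenvalues sum to the trace, which is zero because there are no loops. *)
rewrite -mxtrace_diag.
have -> : \tr (diag_mx L) = \tr A.
  by rewrite AE mxtrace_mulC mulmxA mulmxV // mul1mx.
by rewrite /mxtrace big1 // => i _; rewrite mxE Eirr.
Qed.

(** * Both Kemeny constants through the adjacency eigenvalues *)

Lemma card_arc : N%:R = n%:R * d%:R :> algC.
Proof.
have := sum_arcs E (fun _ _ => 1 : algC); rewrite sumr_const card_ord => ->.
rewrite mulr_natl -sumr_const; apply: eq_big => // u _.
by rewrite sumr_const -(Ed u) /deg cardsE.
Qed.

Variables (U : 'M[algC]_n) (L : 'rV[algC]_n) (i0 : 'I_n).
Hypotheses (uU : U \in unitmx) (AE : A = invmx U *m diag_mx L *m U).
Hypothesis (Li0 : L 0 i0 = d%:R).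
Hypothesis (Llt : forall i, i != i0 -> L 0 i < d%:R).

(** Kemeny's constant of the simple random walk on the vertices. *)
Let K := \sum_(i | i != i0) (1 - d%:R^-1 * L 0 i)^-1.

Lemma map_adjacency : map_mx polyC A = adjacency_mx E {poly algC}.
Proof. by apply/matrixP=> i j; rewrite !mxE rmorph_nat. Qed.

Lemma kemeny_eE : (0 < d)%N -> kemeny_e E = n%:R * (d%:R - 1) + K.
Proof.
move=> d0; rewrite /kemeny_e kemenyE.
pose c : algC := d%:R^-1.
have PE : char_poly (edge_walk_mx E) * 'X^n
    = 'X^N * \prod_i ('X - (c * L 0 i)%:P).
  have -> : char_poly (edge_walk_mx E) = \det ('X%:M
     - (c%:P *: target_mx E {poly algC}) *m (source_mx E {poly algC})^T).
    congr (\det (_ - _)); apply/matrixP=> i j; rewrite -scalemxAl !mxE.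
    have := target_source {poly algC} i j; rewrite mxE => ->.
    by rewrite Ed; case: eqP; rewrite ?mulr1 ?mulr0.
  rewrite det_sylvester -scalemxAr source_target -map_adjacency.
  rewrite (det_diagonalizable _ _ uU AE); congr (_ * _).
  by apply: eq_bigr => i _; rewrite polyCM.
have /(congr1 inv_root_sum) := PE.
rewrite !inv_root_sumM ?char_poly_monic ?monicXn ?monic_prod //; last first.
  by move=> i _; rewrite monicXsubC.
rewrite !inv_root_sumX ?monicX // inv_root_sum_bigprod => [|i]; last exact: monicXsubC.
have -> : inv_root_sum 'X = 1.
  by have := inv_root_sum_XsubC 0; rewrite !subr0 invr1.
(* The top eigenvalue yields the root 1, whose term is [0^-1 = 0]. The powers of ['X] account for nd
   - n zero eigenvalues, each contributing 1. *)
rewrite (bigD1 i0) //= inv_root_sum_XsubC Li0 mulVf ?pnatr_eq0 -?lt0n //.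
rewrite subrr invr0 add0r card_arc => h.
apply: (addIr n%:R); rewrite h /K.
under eq_bigr do rewrite inv_root_sum_XsubC.
by ring.
Qed.

Lemma kemeny_nbE : (2 < d)%N ->
  kemeny_nb E = n%:R * ((d%:R ^+ 2 - d%:R + 1) / d%:R) + (d%:R - 2)^-1
                + (d%:R - 2) / d%:R * K.
Proof.
move=> d3; rewrite /kemeny_nb kemenyE.
pose D : algC := d%:R; pose c : algC := (D - 1)^-1.
have D0 : D != 0 by rewrite pnatr_eq0 -lt0n (ltn_trans _ d3).
have D1 : D - 1 != 0 by rewrite subr_eq0 (eqr_nat _ d 1) gtn_eqF // (ltn_trans _ d3).
have D2 : D - 2 != 0 by rewrite subr_eq0 (eqr_nat _ d 2) gtn_eqF.
have cE : D - 1 = c^-1 by rewrite invrK.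
pose J := reversal_mx E {poly algC}.
pose Q i : {poly algC} := 'X^2 - (c * L 0 i) *: 'X + c%:P.
pose C : {poly algC} := 'X^2 - 0 *: 'X + (- c ^+ 2)%:P.
have CE : 'X^2 - c%:P ^+ 2 = C.
  by rewrite /C scale0r subr0 polyCN rmorphXn.
have Cm : C \is monic := monic_quadratic _ _.
(* The Ihara-Bass identity is squared, since the determinant of the reversal factor is known only
   through its square. *)
have PE : char_poly (nb_walk_mx E) ^+ 2 * C ^+ N * (C ^+ n) ^+ 2
    = (C ^+ N) ^+ 2 * (\prod_i Q i) ^+ 2.
  have -> : char_poly (nb_walk_mx E) = \det ('X%:M - c%:P *:
     (target_mx E {poly algC} *m (source_mx E {poly algC})^T - J)).
    congr (\det (_ - _)); apply/matrixP=> i j; rewrite !mxE.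
    have := target_source {poly algC} i j; rewrite mxE => ->.
    rewrite Ed natrB ?(ltn_trans _ d3) //.
    by do 2![case: eqP => _]; rewrite /= ?subrr ?subr0 ?mulr1 ?mulr0.
  have -> : \prod_i Q i = \det (('X ^+ 2 - c%:P ^+ 2 + c%:P ^+ 2 * d%:R)%:M
      - (c%:P * 'X) *: adjacency_mx E {poly algC}).
    rewrite -map_adjacency (det_diagonalizable _ _ uU AE).
    apply: eq_bigr => i _; rewrite /Q -mul_polyC polyCM.
    have -> : (d%:R : {poly algC}) = D%:P by rewrite rmorph_nat.
    (* Since c (d - 1) = 1, the constant term c^2 (d - 1) is just c. *)
    have key : c%:P = c%:P ^+ 2 * (D%:P - 1).
      by rewrite -rmorphXn -polyC1 -polyCB -polyCM cE expr2 mulfK // invr_eq0.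
    apply/eqP; rewrite -subr_eq0; apply/eqP.
    have <- : c%:P - c%:P ^+ 2 * (D%:P - 1) = 0 by rewrite -key subrr.
    by ring.
  rewrite -CE -[in LHS](det_reversal_sqr Esym 'X c%:P Eirr) -!exprMn.
  by rewrite -(ihara_bass Esym 'X c%:P Ed); congr (_ ^+ 2); ring.
have Pm : char_poly (nb_walk_mx E) \is monic := char_poly_monic _.
have Qm i : Q i \is monic := monic_quadratic _ _.
have QQm : \prod_i Q i \is monic by apply: monic_prod.
have c0 : c != 0 by rewrite invr_eq0.
have c2 : 1 - 0 + - c ^+ 2 = (D - 2) * D * c ^+ 2.
  have -> : D = c^-1 + 1 by rewrite -cE subrK.
  by field.
have /(congr1 inv_root_sum) := PE.
rewrite !inv_root_sumM ?monicMl ?monic_exp // !inv_root_sumX ?monic_exp //.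
rewrite inv_root_sum_bigprod //.
rewrite inv_root_sum_quadratic; last by rewrite c2 !mulf_neq0 ?expf_neq0.
rewrite (bigD1 i0) //=.
(* The top quadratic has roots 1 and c. The first contributes nothing; the second contributes 1 + 1
   / (d - 2). *)
have -> : inv_root_sum (Q i0) = (1 - c)^-1.
  have -> : Q i0 = ('X - 1%:P) * ('X - c%:P).
    have -> : Q i0 = 'X^2 - (1 + c) *: 'X + c%:P.
      by rewrite /Q Li0 -/D -[D](subrK 1) cE mulrDr mulfV // mulr1.
    by rewrite -mul_polyC polyCD polyC1; ring.
  by rewrite inv_root_sumM ?monicXsubC // !inv_root_sum_XsubC subrr invr0 add0r.
have -> : \sum_(i | i != i0) inv_root_sum (Q i) = n%:R - 1 + (D - 2) / D * K.
  (* For L = [L 0 i], each quotient (2 - cL) / (1 - cL + c) equals 1 + (D - 2) / (D - L). *)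
  transitivity (\sum_(i < n | i != i0) (1 + (D - 2) / D * (1 - D^-1 * L 0 i)^-1)).
    apply: eq_bigr => i /Llt Li.
    have DL : D - L 0 i != 0 by rewrite subr_eq0 gt_eqF.
    have e : 1 - c * L 0 i + c = c * (D - L 0 i).
      have -> : D = c^-1 + 1 by rewrite -cE subrK.
      by field.
    rewrite inv_root_sum_quadratic e ?mulf_neq0 // /c.
    by field; rewrite DL D0 D1 //.
  rewrite big_split /= -mulr_sumr; congr (_ + _).
  rewrite sumr_const cardC1 card_ord -subn1 natrB //.
  exact: leq_ltn_trans (ltn_ord i0).
rewrite c2 -[_ *+ N]mulr_natr -[_ / _ *+ n]mulr_natr card_arc -/D.
move: (inv_root_sum _) K n%:R => X k m.
move/(canRL (addrK _))/(canRL (addrK _)); have -> : X + X = X * 2 by ring.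
have two0 : 2%:R != 0 :> algC by rewrite pnatr_eq0.
move/(canRL (mulfK two0)) => ->.
by rewrite /c; field; rewrite D0 D1 D2 /=.
Qed.

(* Termwise tangent line bound [x^-1 >= 2 - x], with equality at [x = 1]. *)
Lemma kemeny_vertex_ge : (0 < d)%N -> \sum_i L 0 i = 0 -> n%:R - 2 <= K.
Proof.
move=> d0 L0; pose D : algC := d%:R.
have D0 : 0 < D by rewrite ltr0n.
(* The n - 1 other eigenvalues sum to -d, hence the value (n - 1) - 1. *)
have <- : \sum_(i | i != i0) (1 + D^-1 * L 0 i) = n%:R - 2.
  rewrite big_split /= -mulr_sumr.
  have := L0; rewrite (bigD1 i0) //= Li0 -/D => /eqP.
  rewrite addrC addr_eq0 => /eqP ->.
  rewrite sumr_const cardC1 card_ord -subn1 natrB ?mulrN ?mulVf ?gt_eqF //.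
    by ring.
  exact: leq_ltn_trans (ltn_ord i0).
apply: ler_sum => i /Llt Li; rewrite -/D.
have x0 : 0 < 1 - D^-1 * L 0 i by rewrite subr_gt0 mulrC ltr_pdivrMr // mul1r.
move: (D^-1 * L 0 i) x0 => y y0; rewrite -subr_ge0.
have -> : (1 - y)^-1 - (1 + y) = y ^+ 2 * (1 - y)^-1.
  by field; rewrite gt_eqF.
(* A square in [algC] is nonnegative only for a real number; [y] is real because 1 - y is
   positive. *)
rewrite mulr_ge0 ?invr_ge0 ?(ltW y0) // real_exprn_even_ge0 //.
by rewrite -[y](subKr 1) rpredB ?real1 // gtr0_real.
Qed.

End RegularGraph.

(** * The ratio bound and its limit *)

Lemma kemeny_ratio_le (V : finType) (E : rel V) (d : nat) (eps : algC) :
    (3 <= d)%N -> simple_graph E -> connected_graph E -> regular_graph E d ->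
    0 < eps -> (0 < #|V|)%N -> 3 <= eps * #|V|%:R ->
  kemeny_nb E / kemeny_e E <= 1 - ((d ^ 2)%:R)^-1 + eps.
Proof.
move=> d3 [Esym Eirr] Econ Ed eps0 n0 big.
have d0 : (0 < d)%N by apply: leq_trans d3.
have [U [L [i0 [uU AE Li0 Llt L0]]]] := adjacency_spectrum Esym Eirr Ed n0 Econ.
have := kemeny_vertex_ge Li0 Llt d0 L0.
rewrite (kemeny_eE Ed uU AE Li0 d0) (kemeny_nbE Esym Eirr Ed uU AE Li0 Llt d3).
move: (\sum_(i | _) _) => K; rewrite -subr_ge0 => K0.
have n1 : 0 <= #|V|%:R - 1 :> algC by rewrite subr_ge0 ler1n.
move: (#|V|%:R) n1 big K0 => n n1; rewrite -subr_ge0 => big K0.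
have D3 : 0 <= d%:R - 3 :> algC by rewrite subr_ge0 ler_nat.
rewrite natrX; move: (d%:R : algC) D3 => D D3.
have D2 : 0 < D - 2 by rewrite (_ : D - 2 = D - 3 + 1) ?ltr_wpDl //; ring.
have D1 : 0 < D - 1 by rewrite (_ : D - 1 = D - 2 + 1) ?ltr_wpDl ?ltW //; ring.
have D0 : 0 < D by rewrite -[D](subrK 1) ltr_wpDl // ltW.
have nn : 0 <= n by rewrite -[n](subrK 1) addr_ge0.
have Ke0 : 0 < n * (D - 1) + K.
  have -> : n * (D - 1) + K = n * (D - 3) + (n - 1) *+ 3 + (K - (n - 2)) + 1 by ring.
  by rewrite ltr_wpDl // addr_ge0 // addr_ge0 ?mulrn_wge0 // mulr_ge0.
rewrite ler_pdivrMr // -subr_ge0.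
(* At K = n - 2 and eps = 0 the terms of order n cancel, which is the origin of 1 - 1 / d^2. The
   constant left over is at least -3, and eps n >= 3 absorbs it. *)
have -> : (1 - (D ^+ 2)^-1 + eps) * (n * (D - 1) + K)
    - (n * ((D ^+ 2 - D + 1) / D) + (D - 2)^-1 + (D - 2) / D * K)
  = ((D - 1 + D) / D ^+ 2) * (K - (n - 2)) + eps * (K - (n - 2))
    + eps * (n * (D - 3)) + eps * (n - 1) *+ 2 + (eps * n - 3)
    + ((D - 1) / D) ^+ 2 *+ 2 + (D - 3) / (D - 2).
  by field; rewrite !gt_eqF.
have [e0 D0' D1' D2'] : [/\ 0 <= eps, 0 <= D, 0 <= D - 1 & 0 <= D - 2].
  by rewrite !ltW.
apply: addr_ge0; last by rewrite divr_ge0.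
apply: addr_ge0; last by rewrite mulrn_wge0 // exprn_ge0 // divr_ge0.
apply: addr_ge0 => //.
apply: addr_ge0; last by rewrite mulrn_wge0 // mulr_ge0.
apply: addr_ge0; last by rewrite !mulr_ge0.
apply: addr_ge0; last by rewrite mulr_ge0.
by rewrite mulr_ge0 // divr_ge0 ?exprn_ge0 // addr_ge0.
Qed.

(** The limit is read as an upper limit, so convergence of the ratios is not presupposed. *)
Theorem theorem3p7 (d : nat) (V : nat -> finType) (E : forall k, rel (V k)) :
  (3 <= d)%N ->
  (forall k, simple_graph (E k)) ->
  (forall k, connected_graph (E k)) ->
  (forall k, regular_graph (E k) d) ->
  (forall M : nat, exists K : nat, forall k, (K <= k)%N -> (M <= #|V k|)%N) ->
  forall eps : algC, 0 < eps ->
  exists K : nat, forall k, (K <= k)%N ->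
    kemeny_nb (E k) / kemeny_e (E k) <= 1 - ((d ^ 2)%:R)^-1 + eps.
Proof.
move=> d3 Esimple Econ Ed Vlim eps eps0.
have b0 : 0 <= 3 / eps by rewrite divr_ge0 // ltW.
(* The bound yields eps n >= 3; the successor also makes the vertex set nonempty. *)
have [K hK] := Vlim (Num.bound (3 / eps)).+1.
exists K => k /hK hk; apply: kemeny_ratio_le => //; first exact: leq_trans hk.
rewrite mulrC -ler_pdivrMr // ltW // (lt_le_trans (archi_boundP b0)) //.
by rewrite ler_nat ltnW.
Qed.
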